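(* Let $\mathcal{M}_1$ and $\mathcal{M}_2$ be two unitary magmas. Then the operads $(\mathsf{C}\mathcal{M}_1)*(\mathsf{C}\mathcal{M}_2)$ and $\mathsf{C}(\mathcal{M}_1\times\mathcal{M}_2)$ are isomorphic, where $*$ denotes the Hadamard product of operads.
   Context: All vector spaces are over a field $\mathbb{K}$ of characteristic zero; $[n]=\{1,\dots,n\}$. Operad means nonsymmetric operad in vector spaces, graded by arities $n\ge1$, with partial compositions $\circ_i$ and a unit in arity $1$. The Hadamard product $\mathcal{O}_1*\mathcal{O}_2$ is the operad with $(\mathcal{O}_1*\mathcal{O}_2)(n)=\mathcal{O}_1(n)\otimes\mathcal{O}_2(n)$ and partial compositions defined component-wise. A unitary magma is a set $\mathcal{M}$ with a binary operation $\star$ (not necessarily associative) having a two-sided unit $\mathds{1}_{\mathcal{M}}$; $\mathcal{M}_1\times\mathcal{M}_2$ carries the component-wise operation. An $\mathcal{M}$-clique $\mathfrak{p}$ of arity $n\ge1$ is a map assigning to every arc $(x,y)$, $1\le x<y\le n+1$, a label $\mathfrak{p}(x,y)\in\mathcal{M}$; by convention, the only $\mathcal{M}$-clique of arity $1$ is the one with $\mathfrak{p}(1,2)=\mathds{1}_{\mathcal{M}}$. Put $\mathfrak{p}_0:=\mathfrak{p}(1,n+1)$ and $\mathfrak{p}_i:=\mathfrak{p}(i,i+1)$ for $i\in[n]$. $\mathsf{C}\mathcal{M}$ is the operad whose space $\mathsf{C}\mathcal{M}(n)$ is the linear span of all $\mathcal{M}$-cliques of arity $n$, whose unit is the unique $\mathcal{M}$-clique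 of arity $1$, and where, for $\mathcal{M}$-cliques $\mathfrak{p},\mathfrak{q}$ of arities $n,m$ and $i\in[n]$, $\mathfrak{p}\circ_i\mathfrak{q}$ is the $\mathcal{M}$-clique of arity $n+m-1$ with $$(\mathfrak{p}\circ_i\mathfrak{q})(x,y)=\begin{cases}\mathfrak{p}(x,y)&\text{if }y\le i,\\ \mathfrak{p}(x,y-m+1)&\text{if }x\le i<i+m\le y,\ (x,y)\ne(i,i+m),\\ \mathfrak{p}(x-m+1,y-m+1)&\text{if }i+m\le x,\\ \mathfrak{q}(x-i+1,y-i+1)&\text{if }i\le x<y\le i+m,\ (x,y)\ne(i,i+m),\\ \mathfrak{p}_i\star\mathfrak{q}_0&\text{if }(x,y)=(i,i+m),\\ \mathds{1}_{\mathcal{M}}&\text{otherwise.}\end{cases}$$ *)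

(* Defs.v *)
From HB Require Import structures.
From mathcomp Require Import all_boot all_order all_algebra.
From mathcomp Require Import finmap.
From mathcomp Require Import monalg.
From mathcomp Require Import boolp.
From mathcomp Require Import zify.

Set Implicit Arguments.
Unset Strict Implicit.
Unset Printing Implicit Defensive.

Import GRing.Theory.

Local Open Scope ring_scope.

Section FreeModule.
Variables (K : fieldType) (T : choiceType) (V : lmodType K).
Implicit Types (f : T -> V) (x : {malg K[T]}).

(* {malg K[T]} is the free space on T: no product on T is involved here.
   malg_lift f is the linear extension of f. *)
Definition malg_lift f x : V := \sum_(k <- msupp x) x@_k *: f k.

Lemma malg_liftEw f x (d : {fset T}) : (msupp x `<=` d)%fset ->
  malg_lift f x = \sum_(k <- d) x@_k *: f k.
Proof.
move=> sxd; apply/big_fset_incl => // k _ kx.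
by rewrite mcoeff_outdom // scale0r.
Qed.

Lemma malg_lift_is_linear f : linear (malg_lift f).
Proof.
move=> a x y.
pose d := (msupp x `|` msupp y `|` msupp (a *: x + y))%fset.
rewrite (@malg_liftEw _ (a *: x + y) d) ?fsubsetUr //.
rewrite (@malg_liftEw _ x d); last by rewrite /d -fsetUA fsubsetUl.
rewrite (@malg_liftEw _ y d); last first.
  by rewrite /d -fsetUA fsetUCA fsubsetUl.
rewrite scaler_sumr -big_split /=; apply: eq_bigr => k _.
by rewrite mcoeffD mcoeffZ scalerDl scalerA.
Qed.

HB.instance Definition _ f :=
  GRing.isLinear.Build K {malg K[T]} V *:%R (malg_lift f)
    (malg_lift_is_linear f).

Lemma malg_liftU f k : malg_lift f << k >> = f k.
Proof.
by rewrite /malg_lift msuppU oner_eq0 big_seq_fset1 mcoeffUU scale1r.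
Qed.

Lemma eq_malg_lift f g : f =1 g -> malg_lift f =1 malg_lift g.
Proof. by move=> fg x; apply: eq_bigr => k _; rewrite fg. Qed.

Lemma malg_lift_linearP f g (a : K) x :
  malg_lift (fun k => a *: f k + g k) x = a *: malg_lift f x + malg_lift g x.
Proof.
rewrite scaler_sumr -big_split /=; apply: eq_bigr => k _.
by rewrite scalerDr !scalerA mulrC.
Qed.

Lemma malgEZ x : x = \sum_(k <- msupp x) x@_k *: << k >>.
Proof.
rewrite {1}[x]monalgE; apply: eq_bigr => k _.
by apply/malgP => l; rewrite mcoeffZ !mcoeffU mulr_natr.
Qed.

Lemma malg_linear_ext (f g : {malg K[T]} -> V) : linear f -> linear g ->
  (forall k, f << k >> = g << k >>) -> f =1 g.
Proof.
move=> lf lg fg x.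
pose f' := HB.pack f (GRing.isLinear.Build K {malg K[T]} V *:%R f lf) :
  {linear {malg K[T]} -> V}.
pose g' := HB.pack g (GRing.isLinear.Build K {malg K[T]} V *:%R g lg) :
  {linear {malg K[T]} -> V}.
rewrite -[f x]/(f' x) -[g x]/(g' x) [x]malgEZ !linear_sum.
by apply: eq_bigr => k _; rewrite !linearZ /=; congr (_ *: _); apply: fg.
Qed.

End FreeModule.

Section Tensor.
Variables (K : fieldType) (U V : lmodType K).

(* The subspace of the free space on U * V spanned by the bilinearity
   relations; U (x) V is the quotient by it. *)
Inductive bilin_span : {malg K[(U * V)%type]} -> Prop :=
| BilinLeft a u u' v :
    bilin_span (<< (a *: u + u', v) >> - (a *: << (u, v) >> + << (u', v) >>))
| BilinRight a u v v' :
    bilin_span (<< (u, a *: v + v') >> - (a *: << (u, v) >> + << (u, v') >>))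
| BilinZero : bilin_span 0
| BilinLin a x y : bilin_span x -> bilin_span y -> bilin_span (a *: x + y).

Definition bilin_pred (x : {malg K[(U * V)%type]}) : bool := `[< bilin_span x >].

Lemma bilin_pred_zmod_closed : zmod_closed bilin_pred.
Proof.
split=> [|x y /asboolP sx /asboolP sy]; apply/asboolP; first exact: BilinZero.
by rewrite addrC -scaleN1r; apply: BilinLin.
Qed.

HB.instance Definition _ :=
  GRing.isZmodClosed.Build {malg K[(U * V)%type]} bilin_pred
    bilin_pred_zmod_closed.

Definition bilin_closed :=
  GRing.ZmodClosed.clone {malg K[(U * V)%type]} bilin_pred _.

Definition tensor : Type := Quotient.quot bilin_closed.

HB.instance Definition _ := GRing.Zmodule.on tensor.
HB.instance Definition _ := Quotient.on tensor.

Local Notation pi := (\pi_tensor)%qT.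

Lemma tensor_piP x y : reflect (pi x = pi y) (bilin_pred (x - y)).
Proof.
have := Quotient.idealrBE bilin_closed x y; rewrite /in_mem /= => ->.
exact: eqP.
Qed.

Lemma tensor_piD x y : pi (x + y) = pi x + pi y.
Proof. exact: (@pi_addr _ _ _ _ _ (Quotient.quot bilin_closed) x y). Qed.

Definition tensor_scale (a : K) (t : tensor) : tensor := pi (a *: repr t).

Lemma tensor_piZ a x : tensor_scale a (pi x) = pi (a *: x).
Proof.
apply/tensor_piP; rewrite -scalerBr; apply/asboolP.
rewrite -[_ *: _]addr0; apply: BilinLin; last exact: BilinZero.
by apply/asboolP/tensor_piP; rewrite reprK.
Qed.

Fact tensor_scaleA a b t :
  tensor_scale a (tensor_scale b t) = tensor_scale (a * b) t.
Proof.
by rewrite -[t]reprK (tensor_piZ b) (tensor_piZ a) (tensor_piZ (a * b)) scalerA.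
Qed.

Fact tensor_scale1 : left_id 1 tensor_scale.
Proof. by move=> t; rewrite -[t in LHS]reprK tensor_piZ scale1r reprK. Qed.

Fact tensor_scaleDr : right_distributive tensor_scale +%R.
Proof.
move=> a t s; rewrite -[t]reprK -[s]reprK -tensor_piD !tensor_piZ scalerDr.
exact: tensor_piD.
Qed.

Fact tensor_scaleDl t : {morph tensor_scale^~ t : a b / a + b}.
Proof.
by move=> a b; rewrite -[t]reprK !tensor_piZ scalerDl tensor_piD.
Qed.

HB.instance Definition _ := GRing.Zmodule_isLmodule.Build K tensor
  tensor_scaleA tensor_scale1 tensor_scaleDr tensor_scaleDl.

Lemma tensor_pi_linear : linear (pi : {malg K[(U * V)%type]} -> tensor).
Proof. by move=> a x y; rewrite tensor_piD -tensor_piZ. Qed.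

Definition tens (u : U) (v : V) : tensor := pi << (u, v) >>.

Lemma tens_linl v : linear (tens^~ v).
Proof.
move=> a u u'; rewrite /tens -tensor_pi_linear; apply/tensor_piP.
by apply/asboolP; apply: BilinLeft.
Qed.

Lemma tens_linr u : linear (tens u).
Proof.
move=> a v v'; rewrite /tens -tensor_pi_linear; apply/tensor_piP.
by apply/asboolP; apply: BilinRight.
Qed.

Lemma tensor_linear_ext (W : lmodType K) (f g : tensor -> W) :
  linear f -> linear g -> (forall u v, f (tens u v) = g (tens u v)) -> f =1 g.
Proof.
move=> lf lg fg t; rewrite -[t]reprK.
apply: (@malg_linear_ext K (U * V)%type W (f \o pi) (g \o pi)).
- by move=> a x y; rewrite /= tensor_pi_linear lf.
- by move=> a x y; rewrite /= tensor_pi_linear lg.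
- by case=> u v; apply: fg.
Qed.

Section Lift.
Variables (W : lmodType K) (f : U -> V -> W).

(* The linear map induced by f when f is bilinear; tensor_lift_pi shows that it
   then does not depend on the chosen representative. *)
Definition tensor_lift (t : tensor) : W :=
  malg_lift (fun uv => f uv.1 uv.2) (repr t).

Hypothesis f_linl : forall v, linear (f^~ v).
Hypothesis f_linr : forall u, linear (f u).

Lemma tensor_lift_pi x :
  tensor_lift (pi x) = malg_lift (fun uv => f uv.1 uv.2) x.
Proof.
rewrite /tensor_lift; set g := fun uv => _.
suff F0 y : bilin_span y -> malg_lift g y = 0.
  apply/eqP; rewrite -subr_eq0 -raddfB; apply/eqP/F0.
  by apply/asboolP/tensor_piP; rewrite reprK.
elim=> [a u u' v|a u v v'||a z z' _ Fz _ Fz'].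
- by rewrite raddfB /= malg_lift_is_linear !malg_liftU /g /= f_linl subrr.
- by rewrite raddfB /= malg_lift_is_linear !malg_liftU /g /= f_linr subrr.
- exact: raddf0.
- by rewrite malg_lift_is_linear Fz Fz' scaler0 addr0.
Qed.

Lemma tensor_liftE u v : tensor_lift (tens u v) = f u v.
Proof. by rewrite tensor_lift_pi malg_liftU. Qed.

Lemma tensor_lift_is_linear : linear tensor_lift.
Proof.
move=> a t s; rewrite -[t]reprK -[s]reprK -tensor_pi_linear !tensor_lift_pi.
exact: malg_lift_is_linear.
Qed.

End Lift.

Lemma tensor_lift_linearP (W : lmodType K) (f g h : U -> V -> W) (a : K) t :
  (forall u v, h u v = a *: f u v + g u v) ->
  tensor_lift h t = a *: tensor_lift f t + tensor_lift g t.
Proof.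
move=> E; rewrite /tensor_lift -malg_lift_linearP.
by apply: eq_malg_lift => -[u v] /=.
Qed.

End Tensor.

Definition sp_cast (K : fieldType) (S : nat -> lmodType K) n m (e : n = m)
  (x : S n) : S m := ecast k (S k) e x.

Lemma sp_cast_linear (K : fieldType) (S : nat -> lmodType K) n m (e : n = m) :
  linear (@sp_cast K S n m e).
Proof. by case: m / e. Qed.

Lemma linear_comp_fun (K : fieldType) (A B C : lmodType K) (f : A -> B) (g : B -> C) :
  linear f -> linear g -> linear (fun x => g (f x)).
Proof. by move=> lf lg a x y; rewrite lf lg. Qed.

(* op_sp O n is the component of arity n.+1, so that arities start at 1, and
   the inputs of its elements are indexed by 'I_n.+1, i.e. from 0. Composing
   arities n.+1 and m.+1 gives arity n.+1 + m.+1 - 1 = (n + m).+1. In op_seqA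
   and op_parA, inord only packs an index which is always in range. *)
Record operad (K : fieldType) := Operad {
  op_sp :> nat -> lmodType K;
  op_comp : forall n m, op_sp n -> 'I_n.+1 -> op_sp m -> op_sp (n + m);
  op_unit : op_sp 0;
  op_linl : forall n m i (y : op_sp m), linear (fun x : op_sp n => op_comp x i y);
  op_linr : forall n m (x : op_sp n) i, linear (@op_comp n m x i);
  op_seqA : forall n m p (x : op_sp n) (y : op_sp m) (z : op_sp p)
      (i : 'I_n.+1) (j : 'I_m.+1),
    op_comp (op_comp x i y) (inord (i + j)) z =
    sp_cast (addnA n m p) (op_comp x i (op_comp y j z));
  op_parA : forall n m p (x : op_sp n) (y : op_sp m) (z : op_sp p)
      (i j : 'I_n.+1), (i < j)%N ->
    op_comp (op_comp x i y) (inord (j + m)) z =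
    sp_cast (addnAC n p m) (op_comp (op_comp x j z) (inord i) y);
  op_unitl : forall n (x : op_sp n), op_comp op_unit ord0 x = x;
  op_unitr : forall n (x : op_sp n) i,
    op_comp x i op_unit = sp_cast (esym (addn0 n)) x
}.

Definition operad_morphism (K : fieldType) (O1 O2 : operad K)
    (f : forall n, {linear O1 n -> O2 n}) : Prop :=
  f 0%N (op_unit O1) = op_unit O2 /\
  forall n m (x : O1 n) (i : 'I_n.+1) (y : O1 m),
    f (n + m)%N (op_comp x i y) = op_comp (f n x) i (f m y).

Definition operad_isomorphic (K : fieldType) (O1 O2 : operad K) : Prop :=
  exists f : forall n, {linear O1 n -> O2 n},
    operad_morphism f /\ forall n, bijective (f n).

Section Hadamard.
Variables (K : fieldType) (O1 O2 : operad K).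

Definition hadamard_sp n : lmodType K := tensor (O1 n) (O2 n).

(* (u (x) v) o_i (u' (x) v') = (u o_i u') (x) (v o_i v'), extended
   bilinearly. *)
Definition hadamard_comp n m (t : hadamard_sp n) (i : 'I_n.+1)
    (s : hadamard_sp m) : hadamard_sp (n + m) :=
  tensor_lift (fun u v =>
    tensor_lift (fun u' v' => tens (op_comp u i u') (op_comp v i v')) s) t.

Let bl n m u v (i : 'I_n.+1) (u' : O1 m) (v' : O2 m) : hadamard_sp (n + m) :=
  tens (op_comp u i u') (op_comp v i v').

Fact hadamard_bl_linl n m u v i v' : linear ((@bl n m u v i)^~ v').
Proof. by move=> a x y; rewrite /bl op_linr tens_linl. Qed.

Fact hadamard_bl_linr n m u v i u' : linear (@bl n m u v i u').
Proof. by move=> a x y; rewrite /bl op_linr tens_linr. Qed.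

Fact hadamard_inl n m i (s : hadamard_sp m) v :
  linear (fun u : O1 n => tensor_lift (bl u v i) s).
Proof.
move=> a u u'; apply: tensor_lift_linearP => x y.
by rewrite /bl op_linl tens_linl.
Qed.

Fact hadamard_inr n m i (s : hadamard_sp m) u :
  linear (fun v : O2 n => tensor_lift (bl u v i) s).
Proof.
move=> a v v'; apply: tensor_lift_linearP => x y.
by rewrite /bl op_linl tens_linr.
Qed.

Lemma hadamard_compE n m u v i u' v' :
  @hadamard_comp n m (tens u v) i (tens u' v') =
  tens (op_comp u i u') (op_comp v i v').
Proof.
rewrite /hadamard_comp tensor_liftE; last 2 first.
- by move=> w; apply: hadamard_inl.
- by move=> w; apply: hadamard_inr.
by rewrite tensor_liftE //; [apply: hadamard_bl_linl|apply: hadamard_bl_linr].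
Qed.

Lemma hadamard_linl n m i (s : hadamard_sp m) :
  linear (fun t : hadamard_sp n => hadamard_comp t i s).
Proof.
by apply: tensor_lift_is_linear => w; [apply: hadamard_inl|apply: hadamard_inr].
Qed.

Lemma hadamard_linr n m (t : hadamard_sp n) i :
  linear (@hadamard_comp n m t i).
Proof.
move=> a s s'; apply: tensor_lift_linearP => u v.
apply: tensor_lift_is_linear => w.
  exact: hadamard_bl_linl.
exact: hadamard_bl_linr.
Qed.

Lemma sp_cast_tens n m (e : n = m) u v :
  @sp_cast K hadamard_sp n m e (tens u v) =
  tens (@sp_cast K O1 n m e u) (@sp_cast K O2 n m e v).
Proof. by case: m / e. Qed.

Definition hadamard_unit : hadamard_sp 0 := tens (op_unit O1) (op_unit O2).

Lemma hadamard_seqA n m p (x : hadamard_sp n) (y : hadamard_sp m)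
    (z : hadamard_sp p) (i : 'I_n.+1) (j : 'I_m.+1) :
  hadamard_comp (hadamard_comp x i y) (inord (i + j)) z =
  sp_cast (addnA n m p) (hadamard_comp x i (hadamard_comp y j z)).
Proof.
have cl := @sp_cast_linear _ hadamard_sp _ _ (addnA n m p).
move: x; apply: tensor_linear_ext => [||u v].
- exact: linear_comp_fun (hadamard_linl i y) (hadamard_linl _ z).
- exact: linear_comp_fun (hadamard_linl i _) cl.
move: y; apply: tensor_linear_ext => [||u' v'].
- exact: linear_comp_fun (hadamard_linr _ i) (hadamard_linl _ z).
- exact: linear_comp_fun (hadamard_linl j z)
    (linear_comp_fun (hadamard_linr _ i) cl).
move: z; apply: tensor_linear_ext => [||u'' v''].
- exact: hadamard_linr.
- exact: linear_comp_fun (hadamard_linr _ j)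
    (linear_comp_fun (hadamard_linr _ i) cl).
by rewrite !hadamard_compE sp_cast_tens !op_seqA.
Qed.

Lemma hadamard_parA n m p (x : hadamard_sp n) (y : hadamard_sp m)
    (z : hadamard_sp p) (i j : 'I_n.+1) : (i < j)%N ->
  hadamard_comp (hadamard_comp x i y) (inord (j + m)) z =
  sp_cast (addnAC n p m) (hadamard_comp (hadamard_comp x j z) (inord i) y).
Proof.
have cl := @sp_cast_linear _ hadamard_sp _ _ (addnAC n p m).
move=> ij; move: x; apply: tensor_linear_ext => [||u v].
- exact: linear_comp_fun (hadamard_linl i y) (hadamard_linl _ z).
- exact: linear_comp_fun (hadamard_linl j z)
    (linear_comp_fun (hadamard_linl _ y) cl).
move: y; apply: tensor_linear_ext => [||u' v'].
- exact: linear_comp_fun (hadamard_linr _ i) (hadamard_linl _ z).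
- exact: linear_comp_fun (hadamard_linr _ _) cl.
move: z; apply: tensor_linear_ext => [||u'' v''].
- exact: hadamard_linr.
- exact: linear_comp_fun (hadamard_linr _ j)
    (linear_comp_fun (hadamard_linl _ _) cl).
by rewrite !hadamard_compE sp_cast_tens !op_parA.
Qed.

Lemma hadamard_unitl n (x : hadamard_sp n) :
  hadamard_comp hadamard_unit ord0 x = x.
Proof.
move: x; apply: tensor_linear_ext => [||u v] //.
- exact: hadamard_linr.
- by rewrite hadamard_compE !op_unitl.
Qed.

Lemma hadamard_unitr n (x : hadamard_sp n) i :
  hadamard_comp x i hadamard_unit = sp_cast (esym (addn0 n)) x.
Proof.
move: x; apply: tensor_linear_ext => [||u v].
- exact: hadamard_linl.
- exact: sp_cast_linear.
- by rewrite hadamard_compE sp_cast_tens !op_unitr.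
Qed.

Definition hadamard : operad K :=
  Operad hadamard_linl hadamard_linr hadamard_seqA hadamard_parA
    hadamard_unitl hadamard_unitr.

End Hadamard.

Section ProdUMagma.
Variables M1 M2 : umagmaType.

Definition prod_mulg (x y : M1 * M2) : M1 * M2 :=
  ((x.1 * y.1)%g, (x.2 * y.2)%g).
Definition prod_oneg : M1 * M2 := (1%g, 1%g).

Fact prod_mul1g : left_id prod_oneg prod_mulg.
Proof. by case=> x y; rewrite /prod_mulg !mul1g. Qed.

Fact prod_mulg1 : right_id prod_oneg prod_mulg.
Proof. by case=> x y; rewrite /prod_mulg !mulg1. Qed.

HB.instance Definition _ := hasMul.Build (M1 * M2)%type prod_mulg.
HB.instance Definition _ :=
  Magma_isUMagma.Build (M1 * M2)%type prod_mul1g prod_mulg1.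

End ProdUMagma.

Section Clique.
Variable M : umagmaType.

(* Vertices are numbered from 0: a clique of arity n.+1 has the n.+2 vertices
   0, ..., n.+1. *)
Definition arc n := {a : 'I_n.+2 * 'I_n.+2 | (a.1 < a.2)%N}.

(* clique n is the set of M-cliques of arity n.+1; the condition says that the
   only edge of a clique of arity 1 is labelled by the unit. *)
Definition clique n :=
  {p : {ffun arc n -> M} | (n == 0)%N ==> [forall a, p a == 1%g]}.

(* The label of the arc (x, y), meaningful for x < y < n.+2. *)
Definition label n (p : clique n) (x y : nat) : M :=
  if insub (inord x, inord y) is Some a then val p a else 1%g.

(* Shifting both vertices and positions to start from 0 turns m, y - m + 1 and
   x - i + 1 into m.+1, y - m and x - i. *)
Definition comp_label n m (p : clique n) (i : nat) (q : clique m)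
    (x y : nat) : M :=
  if (y <= i)%N then label p x y
  else if [&& x <= i, i + m.+1 <= y & (x, y) != (i, i + m.+1)]%N then
    label p x (y - m)
  else if (i + m.+1 <= x)%N then label p (x - m) (y - m)
  else if [&& i <= x, y <= i + m.+1 & (x, y) != (i, i + m.+1)]%N then
    label q (x - i) (y - i)
  else if (x, y) == (i, i + m.+1)%N then
    (label p i i.+1 * label q 0 m.+1)%g
  else 1%g.

Lemma label_lt n (p : clique n) x y (xy : (x < y)%N) (yn : (y < n.+2)%N) :
  exists2 a : arc n, val a = (inord x, inord y) & label p x y = val p a.
Proof.
rewrite /label; case: insubP => [a _ va|]; first by exists a.
by rewrite /= !inordK ?xy // (ltn_trans xy).
Qed.

Lemma label_arc n (p : clique n) (a : arc n) :
  label p (val a).1 (val a).2 = val p a.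
Proof.
by rewrite /label !inord_val -surjective_pairing valK.
Qed.

Lemma clique_ext n (p q : clique n) :
  (forall x y, (x < y)%N -> (y < n.+2)%N -> label p x y = label q x y) ->
  p = q.
Proof.
move=> E; apply/val_inj/ffunP => a; rewrite -!label_arc; apply: E => //.
exact: valP a.
Qed.

Lemma label0 (p : clique 0) x y : label p x y = 1%g.
Proof.
rewrite /label; case: insubP => // a _ _.
by have /forallP/(_ a)/eqP := valP p.
Qed.

Fact clique_comp_subproof n m (p : clique n) (i : 'I_n.+1) (q : clique m) :
  (n + m == 0)%N ==>
  [forall a, [ffun a : arc (n + m) =>
     comp_label p i q (val a).1 (val a).2] a == 1%g].
Proof.
apply/implyP => /eqP nm0; apply/forallP => a; rewrite ffunE.
case: n m i p q a nm0 => [|n] [|m] // i p q a _.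
by rewrite /comp_label !label0 mulg1 !if_same.
Qed.

Definition clique_comp n m (p : clique n) (i : 'I_n.+1) (q : clique m) :
  clique (n + m) :=
  Sub [ffun a : arc (n + m) => comp_label p i q (val a).1 (val a).2]
    (clique_comp_subproof p i q).

Fact clique_unit_subproof :
  (0 == 0)%N ==> [forall a, [ffun _ : arc 0 => 1%g : M] a == 1%g].
Proof. by apply/forallP => a; rewrite ffunE. Qed.

Definition clique_unit : clique 0 := Sub [ffun=> 1%g] clique_unit_subproof.

Lemma label_comp n m (p : clique n) (i : 'I_n.+1) (q : clique m) x y :
  (x < y)%N -> (y < (n + m).+2)%N ->
  label (clique_comp p i q) x y = comp_label p i q x y.
Proof.
move=> xy yn; have [a va ->] := label_lt (clique_comp p i q) xy yn.
by rewrite SubK ffunE va /= !inordK // (ltn_trans xy).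
Qed.

Variant comp_label_spec n m (p : clique n) (i : nat) (q : clique m)
    (x y : nat) : M -> Prop :=
| CompL1 of (y <= i)%N : comp_label_spec p i q x y (label p x y)
| CompL2 of (x <= i)%N & (i + m.+1 <= y)%N & (x < i \/ i + m.+1 < y)%N :
    comp_label_spec p i q x y (label p x (y - m))
| CompL3 of (i + m.+1 <= x)%N :
    comp_label_spec p i q x y (label p (x - m) (y - m))
| CompL4 of (i <= x)%N & (y <= i + m.+1)%N & (i < x \/ y < i + m.+1)%N :
    comp_label_spec p i q x y (label q (x - i) (y - i))
| CompL5 of x = i & y = (i + m.+1)%N :
    comp_label_spec p i q x y (label p i i.+1 * label q 0 m.+1)%g
| CompL6 of (x < i)%N & (i < y < i + m.+1)%N : comp_label_spec p i q x y 1%g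
| CompL7 of (i < x < i + m.+1)%N & (i + m.+1 < y)%N :
    comp_label_spec p i q x y 1%g.

Lemma comp_labelP n m (p : clique n) i (q : clique m) x y : (x < y)%N ->
  comp_label_spec p i q x y (comp_label p i q x y).
Proof.
move=> xy; rewrite /comp_label !xpair_eqE.
case: ifP => [|h1]; first by constructor.
case: ifP => [h|h2]; first by constructor; lia.
case: ifP => [|h3]; first by constructor.
case: ifP => [h|h4]; first by constructor; lia.
case: ifP => [/andP[/eqP -> /eqP ->]|h5]; first by constructor.
have [xi|xi] := ltnP x i; first by constructor; lia.
by apply: CompL7; lia.
Qed.

Definition clique_cast n m (e : n = m) (p : clique n) : clique m :=
  ecast k (clique k) e p.

Lemma label_cast n m (e : n = m) p x y :
  label (@clique_cast n m e p) x y = label p x y.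
Proof. by case: m / e. Qed.

Ltac clique_bash :=
  repeat match goal with
  | |- context [label (clique_comp ?p ?i ?q) ?x ?y] =>
      rewrite (@label_comp _ _ p i q x y); [| lia | lia]
  | |- context [comp_label ?p ?i ?q ?x ?y] =>
      case: (@comp_labelP _ _ p i q x y); [lia | intros; try (exfalso; lia) ..]
  end;
  rewrite ?mulg1 ?mul1g //;
  try (by repeat (congr (label _ _ _) || congr (_ * _)%g); lia).

Lemma clique_seqA n m k (p : clique n) (q : clique m) (r : clique k)
    (i : 'I_n.+1) (j : 'I_m.+1) :
  clique_comp (clique_comp p i q) (inord (i + j)) r =
  clique_cast (addnA n m k) (clique_comp p i (clique_comp q j r)).
Proof.
have iP := ltn_ord i; have jP := ltn_ord j.
have ijP : (inord (i + j) : 'I_(n + m).+1) = (i + j)%N :> nat.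
  by rewrite inordK //; lia.
apply: clique_ext => x y xy yn; rewrite label_cast.
clique_bash.
(* the edge of p at i receives both q and r: q has arity 1 *)
have m0 : m = 0%N by lia.
by subst m; rewrite !label0 mulg1 mul1g.
Qed.

Lemma clique_parA n m k (p : clique n) (q : clique m) (r : clique k)
    (i j : 'I_n.+1) : (i < j)%N ->
  clique_comp (clique_comp p i q) (inord (j + m)) r =
  clique_cast (addnAC n k m) (clique_comp (clique_comp p j r) (inord i) q).
Proof.
move=> ij; have iP := ltn_ord i; have jP := ltn_ord j.
have jmP : (inord (j + m) : 'I_(n + m).+1) = (j + m)%N :> nat.
  by rewrite inordK //; lia.
have iiP : (inord i : 'I_(n + k).+1) = i :> nat by rewrite inordK //; lia.
apply: clique_ext => x y xy yn; rewrite label_cast.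
clique_bash.
Qed.

Lemma clique_unitl n (p : clique n) : clique_comp clique_unit ord0 p = p.
Proof.
apply: clique_ext => x y xy yn; rewrite label_comp //.
case: comp_labelP => //=; intros; try (exfalso; lia).
  by rewrite !subn0.
by rewrite label0 mul1g; congr (label _ _ _); lia.
Qed.

Lemma clique_unitr n (p : clique n) i :
  clique_comp p i clique_unit = clique_cast (esym (addn0 n)) p.
Proof.
have iP := ltn_ord i.
apply: clique_ext => x y xy yn; rewrite label_cast.
clique_bash.
by rewrite label0 mulg1; congr (label _ _ _); lia.
Qed.

End Clique.

Section CliqueOperad.
Variables (K : fieldType) (M : umagmaType).

Definition clique_sp n : lmodType K := {malg K[clique M n]}.

Definition clique_sp_comp n m (x : clique_sp n) (i : 'I_n.+1)
    (y : clique_sp m) : clique_sp (n + m) :=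
  malg_lift (fun p =>
    malg_lift (fun q => << clique_comp p i q >> : clique_sp (n + m)) y) x.

Definition clique_sp_unit : clique_sp 0 := << clique_unit M >>.

Lemma clique_sp_compE n m (p : clique M n) i (q : clique M m) :
  clique_sp_comp << p >> i << q >> = << clique_comp p i q >>.
Proof. by rewrite /clique_sp_comp !malg_liftU. Qed.

Lemma clique_sp_linl n m i (y : clique_sp m) :
  linear (fun x : clique_sp n => clique_sp_comp x i y).
Proof. exact: malg_lift_is_linear. Qed.

Lemma clique_sp_linr n m (x : clique_sp n) i :
  linear (@clique_sp_comp n m x i).
Proof.
move=> a y z; rewrite /clique_sp_comp -malg_lift_linearP.
by apply: eq_malg_lift => p; rewrite malg_lift_is_linear.
Qed.

Lemma sp_cast_clique n m (e : n = m) (p : clique M n) :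
  sp_cast (S := clique_sp) e << p >> = << clique_cast e p >>.
Proof. by case: m / e. Qed.

Lemma clique_sp_seqA n m p (x : clique_sp n) (y : clique_sp m)
    (z : clique_sp p) (i : 'I_n.+1) (j : 'I_m.+1) :
  clique_sp_comp (clique_sp_comp x i y) (inord (i + j)) z =
  sp_cast (addnA n m p) (clique_sp_comp x i (clique_sp_comp y j z)).
Proof.
have cl := @sp_cast_linear _ clique_sp _ _ (addnA n m p).
move: x; apply: malg_linear_ext => [||u].
- exact: linear_comp_fun (clique_sp_linl i y) (clique_sp_linl _ z).
- exact: linear_comp_fun (clique_sp_linl i _) cl.
move: y; apply: malg_linear_ext => [||v].
- exact: linear_comp_fun (clique_sp_linr _ i) (clique_sp_linl _ z).
- exact: linear_comp_fun (clique_sp_linl j z)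
    (linear_comp_fun (clique_sp_linr _ i) cl).
move: z; apply: malg_linear_ext => [||w].
- exact: clique_sp_linr.
- exact: linear_comp_fun (clique_sp_linr _ j)
    (linear_comp_fun (clique_sp_linr _ i) cl).
by rewrite !clique_sp_compE sp_cast_clique clique_seqA.
Qed.

Lemma clique_sp_parA n m p (x : clique_sp n) (y : clique_sp m)
    (z : clique_sp p) (i j : 'I_n.+1) : (i < j)%N ->
  clique_sp_comp (clique_sp_comp x i y) (inord (j + m)) z =
  sp_cast (addnAC n p m) (clique_sp_comp (clique_sp_comp x j z) (inord i) y).
Proof.
have cl := @sp_cast_linear _ clique_sp _ _ (addnAC n p m).
move=> ij; move: x; apply: malg_linear_ext => [||u].
- exact: linear_comp_fun (clique_sp_linl i y) (clique_sp_linl _ z).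
- exact: linear_comp_fun (clique_sp_linl j z)
    (linear_comp_fun (clique_sp_linl _ y) cl).
move: y; apply: malg_linear_ext => [||v].
- exact: linear_comp_fun (clique_sp_linr _ i) (clique_sp_linl _ z).
- exact: linear_comp_fun (clique_sp_linr _ _) cl.
move: z; apply: malg_linear_ext => [||w].
- exact: clique_sp_linr.
- exact: linear_comp_fun (clique_sp_linr _ j)
    (linear_comp_fun (clique_sp_linl _ _) cl).
by rewrite !clique_sp_compE sp_cast_clique clique_parA.
Qed.

Lemma clique_sp_unitl n (x : clique_sp n) :
  clique_sp_comp clique_sp_unit ord0 x = x.
Proof.
move: x; apply: malg_linear_ext => [||u] //.
- exact: clique_sp_linr.
- by rewrite clique_sp_compE clique_unitl.
Qed.

Lemma clique_sp_unitr n (x : clique_sp n) i :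
  clique_sp_comp x i clique_sp_unit = sp_cast (esym (addn0 n)) x.
Proof.
move: x; apply: malg_linear_ext => [||u].
- exact: clique_sp_linl.
- exact: sp_cast_linear.
- by rewrite clique_sp_compE sp_cast_clique clique_unitr.
Qed.

Definition clique_operad : operad K :=
  Operad clique_sp_linl clique_sp_linr clique_sp_seqA clique_sp_parA
    clique_sp_unitl clique_sp_unitr.

End CliqueOperad.

(* Main.v *)
Require Import Defs.
From mathcomp Require Import all_boot all_order all_algebra.
From HB Require Import structures.
From mathcomp Require Import monalg.

(** A clique labelled by [M1 * M2] is the same thing as a pair of cliques of
    the same arity, labelled by [M1] and by [M2]: take the two components of
    every label. The tensor product of the free spaces on two sets is the free
    space on their product, so the linear map sending [<< p >>] (x) [<< q >>] to
    the basis element of the clique labelled by pairs is invertible in each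
    arity; its inverse sends [<< r >>] to the tensor product of the two
    projections of [r].

    Compatibility with composition need only be checked on basis elements.
    There it says that the two projections commute with the composition of
    cliques, which holds for relabelling along any morphism of unitary magmas
    ([clique_map_comp]): the label of a composite at an arc is a label of one of
    the factors, the unit, or a product of two labels. *)

Set Implicit Arguments.
Unset Strict Implicit.
Unset Printing Implicit Defensive.

Import GRing.Theory.

Local Open Scope ring_scope.

Section FreeTensor.
Variables (K : fieldType) (S T : choiceType) (W : lmodType K).

(** This map and [free_tensor_linear_ext] make [tensor {malg K[S]} {malg K[T]}]
    free on the tensors of basis elements. *)
Definition free_tensor_lift (h : S -> T -> W)
    (t : tensor {malg K[S]} {malg K[T]}) : W :=
  tensor_lift (fun u v => malg_lift (fun p => malg_lift (h p) v) u) t.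

Let free_tensor_linl (h : S -> T -> W) v :
  linear (fun u : {malg K[S]} => malg_lift (fun p => malg_lift (h p) v) u).
Proof. exact: malg_lift_is_linear. Qed.

Let free_tensor_linr (h : S -> T -> W) u :
  linear (fun v : {malg K[T]} => malg_lift (fun p => malg_lift (h p) v) u).
Proof.
move=> a y z; rewrite -malg_lift_linearP.
by apply: eq_malg_lift => p; rewrite malg_lift_is_linear.
Qed.

Lemma free_tensor_lift_is_linear h : linear (free_tensor_lift h).
Proof.
apply: tensor_lift_is_linear => w; first exact: free_tensor_linl.
exact: free_tensor_linr.
Qed.

HB.instance Definition _ h :=
  GRing.isLinear.Build K (tensor {malg K[S]} {malg K[T]}) W *:%R
    (free_tensor_lift h) (free_tensor_lift_is_linear h).

Lemma free_tensor_liftU h p q :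
  free_tensor_lift h (tens << p >> << q >>) = h p q.
Proof.
by rewrite /free_tensor_lift tensor_liftE ?malg_liftU.
Qed.

Lemma free_tensor_linear_ext (f g : tensor {malg K[S]} {malg K[T]} -> W) :
  linear f -> linear g ->
  (forall p q, f (tens << p >> << q >>) = g (tens << p >> << q >>)) -> f =1 g.
Proof.
move=> lf lg fg; apply: tensor_linear_ext => // u v.
move: u; apply: malg_linear_ext => [||p].
- exact: linear_comp_fun (tens_linl v) lf.
- exact: linear_comp_fun (tens_linl v) lg.
move: v; apply: malg_linear_ext => [||q] //.
- exact: linear_comp_fun (tens_linr _) lf.
- exact: linear_comp_fun (tens_linr _) lg.
Qed.

End FreeTensor.

Section CliqueMap.
Variables (M N : umagmaType) (f : M -> N).
Hypothesis f1 : f 1%g = 1%g.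

Fact clique_map_subproof n (p : clique M n) :
  (n == 0) ==> [forall a, [ffun a => f (val p a)] a == 1%g].
Proof.
have /implyP p1 := valP p; apply/implyP => /p1/forallP{}p1.
by apply/forallP => a; rewrite ffunE (eqP (p1 a)) f1.
Qed.

Definition clique_map n (p : clique M n) : clique N n :=
  Sub [ffun a => f (val p a)] (clique_map_subproof p).

Lemma label_map n (p : clique M n) x y :
  label (clique_map p) x y = f (label p x y).
Proof. by rewrite /label; case: insubP => // a _ _; rewrite SubK ffunE. Qed.

Hypothesis fM : {morph f : x y / (x * y)%g}.

(** Each case of the definition of a composite label is a label of a factor,
    the unit, or a product of two labels, and [f] preserves all three. *)
Lemma clique_map_comp n m (p : clique M n) (i : 'I_n.+1) (q : clique M m) :
  clique_map (clique_comp p i q) =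
  clique_comp (clique_map p) i (clique_map q).
Proof.
apply: clique_ext => x y xy yn; rewrite label_map !label_comp //.
(* pull [f] out of the nested case distinction, reading the unit as [f 1] *)
by rewrite /comp_label !label_map -fM -f1 -!(fun_if f).
Qed.

End CliqueMap.

Section CliquePair.
Variables M1 M2 : umagmaType.

Fact clique_pair_subproof n (p : clique M1 n) (q : clique M2 n) :
  (n == 0) ==>
  [forall a, [ffun a => (val p a, val q a) : M1 * M2] a == 1%g].
Proof.
have /implyP p1 := valP p; have /implyP q1 := valP q.
apply/implyP => n0; apply/forallP => a; rewrite ffunE.
by rewrite (eqP (forallP (p1 n0) a)) (eqP (forallP (q1 n0) a)).
Qed.

Definition clique_pair n (p : clique M1 n) (q : clique M2 n) :
    clique (M1 * M2)%type n :=
  Sub [ffun a => (val p a, val q a)] (clique_pair_subproof p q).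

Definition clique_fst n (r : clique (M1 * M2)%type n) : clique M1 n :=
  clique_map (f := fst) erefl r.
Definition clique_snd n (r : clique (M1 * M2)%type n) : clique M2 n :=
  clique_map (f := snd) erefl r.

Lemma clique_fst_pair n (p : clique M1 n) (q : clique M2 n) :
  clique_fst (clique_pair p q) = p.
Proof. by apply/val_inj/ffunP => a; rewrite !SubK !ffunE. Qed.

Lemma clique_snd_pair n (p : clique M1 n) (q : clique M2 n) :
  clique_snd (clique_pair p q) = q.
Proof. by apply/val_inj/ffunP => a; rewrite !SubK !ffunE. Qed.

Lemma clique_pair_eta n (r : clique (M1 * M2)%type n) :
  clique_pair (clique_fst r) (clique_snd r) = r.
Proof.
by apply/val_inj/ffunP => a; rewrite !SubK !ffunE -surjective_pairing.
Qed.

Lemma clique_pair_unit :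
  clique_pair (clique_unit M1) (clique_unit M2) = clique_unit (M1 * M2)%type.
Proof. by apply: clique_ext => x y _ _; rewrite !label0. Qed.

(** A clique labelled by pairs is determined by its two projections, which
    commute with composition, so the pairing commutes with it as well. *)
Lemma clique_pair_comp n m (p : clique M1 n) (q : clique M2 n) (i : 'I_n.+1)
    (p' : clique M1 m) (q' : clique M2 m) :
  clique_pair (clique_comp p i p') (clique_comp q i q') =
  clique_comp (clique_pair p q) i (clique_pair p' q').
Proof.
rewrite -[RHS]clique_pair_eta /clique_fst /clique_snd !clique_map_comp //.
by rewrite -!/(clique_fst _) -!/(clique_snd _) !clique_fst_pair !clique_snd_pair.
Qed.

End CliquePair.

Theorem proposition2p1p2 (K : fieldType) (K_char0 : [pchar K] =i pred0)
    (M1 M2 : umagmaType) :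
  operad_isomorphic
    (hadamard (clique_operad K M1) (clique_operad K M2))
    (clique_operad K (M1 * M2)%type).
Proof.
pose H := hadamard (clique_operad K M1) (clique_operad K M2).
pose C := clique_operad K (M1 * M2)%type.
pose f n : {linear H n -> C n} :=
  free_tensor_lift (fun p q => << clique_pair p q >> : C n).
pose g n : C n -> H n := malg_lift (fun r =>
  tens (<< clique_fst r >> : clique_sp K M1 n)
       (<< clique_snd r >> : clique_sp K M2 n)).
have fU n p q : f n (tens << p >> << q >>) = << clique_pair p q >>.
  exact: free_tensor_liftU.
have flin n : linear (f n) by exact: free_tensor_lift_is_linear.
have glin n : linear (g n) by exact: malg_lift_is_linear.
exists f; split; last first.
  move=> n; exists (g n).
    apply: (free_tensor_linear_ext (linear_comp_fun (flin n) (glin n))) => //.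
    by move=> p q; rewrite fU /g malg_liftU clique_fst_pair clique_snd_pair.
  apply: (malg_linear_ext (linear_comp_fun (glin n) (flin n))) => // r.
  by rewrite /g malg_liftU fU clique_pair_eta.
split; first by rewrite [LHS]fU clique_pair_unit.
move=> n m x i y.
move: x; apply: free_tensor_linear_ext => [||p q].
- exact: linear_comp_fun (op_linl i y) (flin _).
- exact: linear_comp_fun (flin _) (op_linl i _).
move: y; apply: free_tensor_linear_ext => [||p' q'].
- exact: linear_comp_fun (op_linr _ i) (flin _).
- exact: linear_comp_fun (flin _) (op_linr _ i).
have HU : @op_comp _ H n m (tens << p >> << q >>) i (tens << p' >> << q' >>) =
    tens << clique_comp p i p' >> << clique_comp q i q' >>.
  apply: etrans (hadamard_compE _ _ _ _ _) _.
  exact: (f_equal2 (@tens K (clique_sp K M1 (n + m)) (clique_sp K M2 (n + m)))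
    (clique_sp_compE K p i p') (clique_sp_compE K q i q')).
have CU := clique_sp_compE K (clique_pair p q) i (clique_pair p' q').
rewrite HU !fU clique_pair_comp; exact: esym CU.
Qed.
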